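(* Let $X$ be a uniformly convex and uniformly smooth Banach space and let $\psi \in \mathfrak{M}$. The following statements are equivalent: (1) there exists $k_1 > 0$ such that $\Omega_{PS}(R) \subset \Omega_N^{k_1\psi}(R)$ for any $R > 0$; (2) $\rho_X(\tau) = O(\psi(\tau))$ as $\tau \to 0$.
   Context: $X$ is a real Banach space with dual $X^*$; $\langle p, x\rangle$ is the value of $p\in X^*$ at $x\in X$; $\mathfrak{B}_\delta(a)$ is the closed ball with center $a$ and radius $\delta$; $\operatorname{dist}(x,A)=\inf_{a\in A}\|x-a\|$. Modulus of smoothness: $\rho_X(\tau)=\sup\{\frac{\|x+y\|}{2}+\frac{\|x-y\|}{2}-1:\ \|x\|=1,\ \|y\|=\tau\}$, $\tau\ge 0$. $X$ is uniformly smooth if $\rho_X(\tau)/\tau\to 0$ as $\tau\to+0$. Modulus of convexity: $\delta_X(\varepsilon)=\inf\{1-\frac{\|x+y\|}{2}:\ \|x\|\le 1,\|y\|\le 1,\ \|x-y\|\ge\varepsilon\}$, $\varepsilon\in[0,2]$. $X$ is uniformly convex if $\delta_X(\varepsilon)>0$ for all $\varepsilon\in(0,2]$. A set $A\subset X$ is proximally smooth with constant $R>0$ if the function $x\mapsto \operatorname{dist}(x,A)$ is continuously differentiable on $U(R,A)=\{x\in X: 0<\operatorname{dist}(x,A)<R\}$. $\Omega_{PS}(R)$ is the class of all closed sets in $X$ that are proximally smooth with constant $R$. The normal cone to $A\subset X$ at $a_0\in A$ is $N(a_0,A)=\{p\in X^*:\ \forall \varepsilon>0\ \exists\delta>0\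 \forall a\in A\cap \mathfrak{B}_\delta(a_0):\ \langle p,a-a_0\rangle\le\varepsilon\|a-a_0\|\}$. For $\psi:[0,+\infty)\to[0,+\infty)$ and $R>0$, $\Omega_N^{\psi}(R)$ is the class of all closed sets $A\subset X$ for which there is some $\varepsilon>0$ (depending on $A$) such that for any $x_1,x_2\in A$ with $\|x_1-x_2\|\le\varepsilon$ and any $p_i\in N(x_i,A)$ with $\|p_i\|=1$ ($i=1,2$) one has $\langle p_2-p_1,x_2-x_1\rangle\ge -R\,\psi\left(\frac{\|x_2-x_1\|}{R}\right)$. For $k>0$, $k\psi$ denotes the function $t\mapsto k\,\psi(t)$. $\mathfrak{M}$ is the class of convex and Lipschitz functions $\psi:[0,+\infty)\to[0,+\infty)$ with $\psi(0)=0$. *)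

(* Defs.v *)
From HB Require Import structures.
From mathcomp Require Import all_boot all_order all_algebra.
From mathcomp Require Import all_classical all_reals all_analysis.

Set Implicit Arguments.
Unset Strict Implicit.
Unset Printing Implicit Defensive.

Import Order.TTheory GRing.Theory Num.Theory.
Import numFieldNormedType.Exports.

Local Open Scope classical_set_scope.
Local Open Scope ring_scope.

Section BanachGeometry.
Context {R : realType}.
Implicit Type X : completeNormedModType R.

(* The set below is bounded above by tau; it is empty only when X is the zero
   space (for tau >= 0), in which case the real-valued sup is 0. *)
Definition modulus_smoothness X (tau : R) : R :=
  sup [set r | exists x y : X, [/\ `|x| = 1, `|y| = tau &
    r = `|x + y| / 2 + `|x - y| / 2 - 1]].

Definition uniformly_smooth X : Prop :=
  modulus_smoothness X tau / tau @[tau --> 0^'+] --> (0 : R).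

(* Extended-real infimum, so that the infimum of the empty set is +oo: the
   zero space is uniformly convex. *)
Definition modulus_convexity X (eps : R) : \bar R :=
  ereal_inf [set r | exists x y : X, [/\ `|x| <= 1, `|y| <= 1,
    eps <= `|x - y| & r = (1 - `|x + y| / 2)%:E]].

Definition uniformly_convex X : Prop :=
  forall eps : R, 0 < eps <= 2 -> (0 < modulus_convexity X eps)%E.

(* X^* is the set of continuous p : {linear X -> R^o}. This is its norm; it is
   stated on plain functions so that it applies to differences of
   differentials, and is meaningful only for bounded linear p. *)
Definition dual_norm X (p : X -> R) : R :=
  sup [set `|p x| | x in [set x : X | `|x| <= 1]].

(* Since inf set0 = 0, the tube below is empty when A is empty, just as with
   the convention dist(x, set0) = +oo. *)
Definition dist_to X (A : set X) (x : X) : R := inf [set `|x - a| | a in A].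

Definition tube X (r : R) (A : set X) : set X :=
  [set x | 0 < dist_to A x < r].

Definition continuously_differentiable_on X (U : set X) (f : X -> R^o) : Prop :=
  (forall x, U x -> differentiable f x) /\
  (forall x, U x ->
    dual_norm ('d f y \- 'd f x) @[y --> within U (nbhs x)] --> (0 : R)).

Definition proximally_smooth X (r : R) (A : set X) : Prop :=
  continuously_differentiable_on (tube r A) (dist_to A).

Definition Omega_PS X (r : R) : set (set X) :=
  [set A | closed A /\ proximally_smooth r A].

Definition normal_cone X (a0 : X) (A : set X) : set {linear X -> R^o} :=
  [set p | continuous p /\
    forall eps : R, 0 < eps -> exists2 delta : R, 0 < delta &
      forall a, (A `&` closed_ball a0 delta) a ->
        p (a - a0) <= eps * `|a - a0| ].

Definition Omega_N X (psi : R -> R) (r : R) : set (set X) :=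
  [set A | closed A /\
    exists2 eps : R, 0 < eps &
      forall x1 x2 : X, A x1 -> A x2 -> `|x1 - x2| <= eps ->
      forall p1 p2 : {linear X -> R^o},
        normal_cone x1 A p1 -> normal_cone x2 A p2 ->
        dual_norm p1 = 1 -> dual_norm p2 = 1 ->
        p2 (x2 - x1) - p1 (x2 - x1) >= - (r * psi (`|x2 - x1| / r))].

(* A function [0, +oo[ -> [0, +oo[ is encoded as psi : R -> R constrained on
   [0, +oo[ only; its values at negative reals are irrelevant. *)
Definition class_M : set (R -> R) :=
  [set psi | [/\ forall t, 0 <= t -> 0 <= psi t,
    convex_function (`[0, +oo[%classic : set R^o) psi,
    [lipschitz psi t | t in `[0, +oo[%classic] &
    psi 0 = 0]].

End BanachGeometry.

Arguments modulus_smoothness {R} X tau.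
Arguments uniformly_smooth {R} X.
Arguments modulus_convexity {R} X eps.
Arguments uniformly_convex {R} X.
Arguments Omega_PS {R} X r.
Arguments Omega_N {R} X psi r.

(* Main.v *)
Require Import Defs.
From HB Require Import structures.
From mathcomp Require Import all_boot all_order all_algebra.
From mathcomp Require Import all_classical all_reals all_analysis.
From mathcomp Require Import ring lra.
Import Order.TTheory GRing.Theory Num.Theory.
Import numFieldNormedType.Exports.
Local Open Scope classical_set_scope.
Local Open Scope ring_scope.

(** Write rho for the modulus of smoothness and d for the distance to A.

    From the bound on rho to the inclusion. The key point is that a proximally
    smooth set has exterior balls of the full radius r: if p is a unit normal
    at x0 and u is a unit vector normed by p, then no point of A is at distance
    less than r from x0 + r u (normal_ball_disjoint). To see this, note first
    that at a point of the tube where d is Frechet differentiable, d decreases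
    with slope -1 towards almost nearest points of A, hence increases with
    slope 1 in the opposite direction (dist_to_ascent). Completeness of X lets
    these infinitesimal steps be chained: from any x in the tube one reaches
    any height s < r by a path of total length about s - d x (slope_climb,
    dist_to_climb). Start the climb at x = x0 + t u with t tiny. There d x is
    about t because p is normal, and the end point y of the climb satisfies d y
    = s although it is joined to a nearly nearest point of x by a broken line
    of length about s. Uniform convexity makes this broken line straight, with
    direction u, so y is close to x0 + s u and d (x0 + s u) >= s
    (normal_ray_dist). Given the exterior ball, for a in A the vectors u + (a -
    x0)/r and u - (a - x0)/r have norm at least 1 + p (a - x0)/r and 1
    respectively, and the definition of rho gives p (a - x0) <= 2 r rho(|a -
    x0|/r). Adding the bounds at the two points yields the inclusion with k1 =
    4 C when rho <= C psi near 0.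

    From the inclusion to the bound on rho. A single set suffices, the
    complement of the open unit ball, with r = 1. Its distance function is 1 -
    |x| on the tube, and it is C^1 because the norm of a uniformly smooth space
    is C^1 away from 0 (norm_diff, dnorm_continuous). Its unit normals at
    points of the sphere include minus the differential of the norm, so the
    hypothesis says that this differential j satisfies (j x2 - j x1)(x2 - x1)
    <= k1 psi(|x2 - x1|) for nearby unit vectors. The quantity |x + y| + |x -
    y| - 2 is at most the increment of j(.)(y) from x - y to x + y. Cutting
    this segment into eight pieces makes the directions of consecutive points
    at distance at most |y|, so each piece contributes a multiple of psi(|y|)
    (second_difference_le); with coarser pieces psi would be evaluated at a
    multiple of |y|, and a convex psi need not be doubling. *)

Section Banach.
Context {R : realType} {X : completeNormedModType R}.
Implicit Types (A : set X) (x y z a b u v w h k : X) (p : {linear X -> R^o})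
  (c e r s t : R).

Local Notation direction z := (`|z|^-1 *: z).

(** * Directions, distance functions and functionals of norm one *)

Lemma scale_unit x : x != 0 -> `|direction x| = 1.
Proof.
by move=> x0; rewrite normrZ normfV normr_id mulVf// normr_eq0.
Qed.

Lemma norm_scale_unit x : `|x| *: direction x = x.
Proof.
have [->|x0] := eqVneq x 0; first by rewrite !scaler0.
by rewrite scalerA mulfV ?normr_eq0// scale1r.
Qed.

(** Almost additivity of the norm on x and y, measured against the shorter
    vector x, forces almost additivity on the two directions: only a piece of y
    of length |x| is compared with x. *)
Lemma norm_add_directions x y : x != 0 -> `|x| <= `|y| ->
  `|y + x| - `|y| + `|x| <= `|x| * `| direction y + direction x|.
Proof.
move=> x0 xy; have y0 : y != 0.
  by rewrite -normr_gt0 (lt_le_trans _ xy)// normr_gt0.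
have -> : y + x = (`|y| - `|x|) *: direction y
                  + `|x| *: (direction y + direction x).
  by rewrite scalerDr !norm_scale_unit scalerBl norm_scale_unit addrA subrK.
have := ler_normD ((`|y| - `|x|) *: direction y)
                  (`|x| *: (direction y + direction x)).
rewrite normrZ scale_unit// mulr1 ger0_norm ?subr_ge0//.
by rewrite [X in _ <= _ + X -> _]normrZ normr_id; lra.
Qed.

Lemma dist_to_le A x a : A a -> dist_to A x <= `|x - a|.
Proof.
move=> Aa; apply: ge_inf; last by exists a.
by exists 0 => _ [b _ <-].
Qed.

Lemma le_dist_to A x (m : R) :
  A !=set0 -> (forall a, A a -> m <= `|x - a|) -> m <= dist_to A x.
Proof.
move=> [a Aa] h; apply: lb_le_inf; first by exists `|x - a|, a.
by move=> _ [b Ab <-]; exact: h.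
Qed.

Lemma dist_to_approx A x e :
  A !=set0 -> 0 < e -> exists2 a, A a & `|x - a| < dist_to A x + e.
Proof.
move=> [a Aa] e0; have [|_ [b Ab <-] ltb] :=
  @inf_adherent _ [set `|x - a| | a in A] e e0; last by exists b.
by split; [exists `|x - a|, a|exists 0 => _ [b _ <-]].
Qed.

Lemma dist_to_lipschitz A x y : dist_to A x - dist_to A y <= `|x - y|.
Proof.
have [A0|/set0P A0] := eqVneq A set0.
  by rewrite /dist_to A0 !image_set0 inf0 subrr.
rewrite lerBlDl -lerBlDr; apply: le_dist_to => // a Aa.
have := dist_to_le A x a Aa; have := ler_distD y x a; lra.
Qed.

(** The real-valued supremum of a set that has no supremum is 0. *)
Lemma dual_norm1_has_sup p : dual_norm p = 1 ->
  has_sup [set `|p x| | x in [set x : X | `|x| <= 1]].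
Proof.
move=> p1; apply: contrapT => /sup_out; rewrite -/(dual_norm p) p1 => /eqP.
by rewrite oner_eq0.
Qed.

Lemma dual_norm1_bound p : dual_norm p = 1 -> forall x, `|p x| <= `|x|.
Proof.
move=> p1 x.
have [_ pub] := dual_norm1_has_sup p p1.
have [->|x0] := eqVneq x 0; first by rewrite linear0 !normr0.
have nx : 0 < `|x| by rewrite normr_gt0.
have : `|p (direction x)| <= dual_norm p.
  by apply: ub_le_sup => //; exists (direction x) => //=; rewrite scale_unit.
by rewrite p1 linearZ/= normrZ normfV normr_id ler_pdivrMl// mulr1.
Qed.

Lemma dual_norm1_le p x : dual_norm p = 1 -> (p x : R) <= `|x|.
Proof.
by move=> p1; exact: le_trans (ler_norm _) (dual_norm1_bound p p1 x).
Qed.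

(** * Uniform convexity and norming vectors *)

Lemma uniform_convexityP : uniformly_convex X -> forall e : R, 0 < e ->
  exists2 del : R, 0 < del & forall v w, `|v| <= 1 -> `|w| <= 1 ->
    2 - del < `|v + w| -> `|v - w| < e.
Proof.
move=> Xuc e e0; pose e' := Num.min e 2.
have [e'0 e'2 e'e] : [/\ 0 < e', e' <= 2 & e' <= e].
  by rewrite /e' lt_min e0 !ge_min !lexx orbT /=; split.
have [del del0 leH] : exists2 del : R, 0 < del &
    forall v w, `|v| <= 1 -> `|w| <= 1 -> e' <= `|v - w| ->
      del <= 1 - `|v + w| / 2.
  move: (Xuc e'); rewrite e'0 e'2 => /(_ isT).
  have le_mod v w : `|v| <= 1 -> `|w| <= 1 -> e' <= `|v - w| ->
    (modulus_convexity X e' <= (1 - `|v + w| / 2)%:E)%E.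
    by move=> v1 w1 vw; apply: ereal_inf_lbound; exists v, w.
  case: (modulus_convexity X e') le_mod => [del||] le_mod // del0.
    by exists del.
  exists 1 => // v w v1 w1 vw; have := le_mod v w v1 w1 vw.
  by rewrite leye_eq.
exists (2 * del); first by lra.
move=> v w v1 w1 vw; rewrite ltNge; apply/negP => evw.
have := leH v w v1 w1 (le_trans e'e evw); lra.
Qed.

Lemma cauchy_seq_cvg (u_ : nat -> X) :
  (forall e : R, 0 < e ->
     exists N, forall n, (N <= n)%N -> `|u_ N - u_ n| < e) ->
  exists l, forall e : R, 0 < e ->
    exists N, forall n, (N <= n)%N -> `|l - u_ n| < e.
Proof.
move=> uC; have /cvg_ex[l ul] : cvgn u_.
  apply: cauchy_cvg; apply: cauchy_exP => e e0; have [N uN] := uC e e0.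
  exists (u_ N); exists N => // n /= Nn.
  by rewrite -ball_normE /=; exact: uN.
exists l => e e0; move/cvgrPdist_lt: ul => /(_ e e0)[N _ uN].
by exists N => n Nn; exact: uN.
Qed.

(** Two almost norming vectors of the unit ball have a sum of norm almost 2, so
    uniform convexity makes a maximizing sequence Cauchy. *)
Lemma norming_vector p : uniformly_convex X -> dual_norm p = 1 ->
  exists u, `|u| = 1 /\ p u = 1.
Proof.
move=> /uniform_convexityP Xuc p1; have pb := dual_norm1_bound p p1.
have [i_ [i_gt0 i_small]] : exists i_ : nat -> R, (forall n, 0 < i_ n) /\
    forall e, 0 < e -> exists N, forall n, (N <= n)%N -> i_ n < e.
  exists (fun n => n.+1%:R^-1); split => [n|e e0]; first by rewrite invr_gt0.
  exists (Num.truncn e^-1) => n Nn.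
  rewrite invf_plt ?posrE//; apply: lt_le_trans (truncnS_gt _) _.
  by rewrite ler_nat.
have next n : exists v, `|v| <= 1 /\ 1 - i_ n < p v.
  have [_ [v v1 <-] +] := sup_adherent (i_gt0 n) (dual_norm1_has_sup p p1).
  rewrite -/(dual_norm p) p1 => pv.
  have [pv0|pv0] := leP 0 (p v); first by exists v; rewrite ger0_norm in pv.
  by exists (- v); rewrite normrN linearN/= -(ltr0_norm pv0).
have [u_ uP] := choice next.
have [|u ul] := cauchy_seq_cvg u_.
  move=> e e0; have [del del0 delP] := Xuc e e0.
  have [N sN] := i_small (del / 2) ltac:(lra).
  exists N => n Nn; have [uN pN] := uP N; have [un pn] := uP n.
  apply: delP => //.
  have := pb (u_ N + u_ n); rewrite linearD/=.
  have := ler_norm (p (u_ N) + p (u_ n)); have := sN _ (leqnn N).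
  have := sN n Nn.
  lra.
have u1 : `|u| <= 1.
  apply/ler_addgt0Pr => e e0; have [N uN] := ul e e0.
  have := uN N (leqnn N); have [uN1 _] := uP N.
  have := lerB_dist u (u_ N); lra.
have pu : 1 <= p u.
  apply/ler_addgt0Pr => e e0; have [N uN] := ul (e / 2) ltac:(lra).
  have [M sM] := i_small (e / 2) ltac:(lra).
  pose k := maxn N M; have := uN k (leq_maxl _ _); have := sM k (leq_maxr _ _).
  have [_] := uP k; have := pb (u - u_ k); rewrite distrC linearB/=.
  have := ler_norm (p (u_ k) - p u); rewrite (distrC (u_ k)).
  rewrite (distrC (p u)); lra.
have := pb u; have := ler_norm (p u); exists u; split; lra.
Qed.

(** * Climbing along the distance function *)

(** A form of the Ekeland principle: relate y to z when f climbs from y to z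
    with average slope at least c.  This is a closed order, and chains of points
    of bounded height are Cauchy, so there is a maximal point below the level s;
    local climbing forces it to lie at height s. *)
Lemma slope_climb (f : X -> R) x c s :
  (forall y z, f y - f z <= `|y - z|) -> 0 < c -> f x <= s ->
  (forall y, f x <= f y < s ->
     exists z, [/\ f z <= s, f y < f z & c * `|z - y| <= f z - f y]) ->
  exists y, f y = s /\ c * `|y - x| <= f y - f x.
Proof.
move=> lip c0 fxs climb.
pose up y z := c * `|z - y| <= f z - f y.
have upxx y : up y y by rewrite /up !subrr normr0 mulr0.
have up_trans y z w : up y z -> up z w -> up y w.
  rewrite /up => yz zw; have := ler_distD z w y.
  rewrite -(ler_pM2l c0) mulrDr; lra.
have up_le y z : up y z -> f y <= f z.
  by rewrite /up => yz; have := mulr_ge0 (ltW c0) (normr_ge0 (z - y)); lra.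
(* Step to a point that realizes at least half of the height still reachable. *)
have next y : exists z, f y <= s -> [/\ f z <= s, up y z &
    forall w, up y w -> f w <= s -> f w - f z <= f z - f y].
  have [fys|] := boolP (f y <= s); last by exists y.
  pose S := [set f w | w in [set w | up y w /\ f w <= s]].
  have Sub : has_ubound S by exists s => _ [w [_ ws] <-].
  have Sy : S (f y) by exists y.
  have leS w : up y w -> f w <= s -> f w <= sup S.
    by move=> yw ws; apply: ub_le_sup => //; exists w.
  have [Sfy|Sfy] := leP (sup S) (f y).
    exists y => _; split => // w yw ws; have := leS w yw ws; lra.
  have /sup_adherent : 0 < (sup S - f y) / 2 by lra.
  case/(_ S); first by split => //; exists (f y).
  move=> _ [z [yz zs] <-] ltz; exists z => _; split => // w yw ws.
  have := leS w yw ws; lra.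
have [g gP] := choice next.
pose u_ n := iter n g x.
have us n : f (u_ n) <= s by elim: n => //= n /gP[].
have uup n m : (n <= m)%N -> up (u_ n) (u_ m).
  elim: m => [|m IH]; first by rewrite leqn0 => /eqP ->.
  rewrite leq_eqVlt => /predU1P[->//|]; rewrite ltnS => /IH.
  by move=> /up_trans; apply; have [] := gP _ (us m).
pose V := [set f (u_ n) | n in setT].
have Vub : has_ubound V by exists s => _ [n _ <-].
have leV n : f (u_ n) <= sup V by apply: ub_le_sup => //; exists n.
have V0 : V !=set0 by exists (f (u_ 0)), 0%N.
have Vapp (e : R) : 0 < e -> exists n, sup V - e < f (u_ n).
  by move=> e0; have [//|_ [n _ <-] ?] := @sup_adherent _ V e e0; exists n.
have [|l ul] := cauchy_seq_cvg u_.
  move=> e e0; have [N VN] := Vapp (c * e) (mulr_gt0 c0 e0).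
  exists N => n Nn; rewrite distrC -(ltr_pM2l c0).
  have := uup _ _ Nn; rewrite /up; have := leV n; lra.
have ul' n (e : R) : 0 < e -> exists m, (n <= m)%N /\ `|l - u_ m| < e.
  move=> e0; have [N uN] := ul e e0; exists (maxn N n).
  by split; [exact: leq_maxr|apply: uN; exact: leq_maxl].
have fl : f l <= s.
  apply/ler_addgt0Pr => e e0; have [m [_ ml]] := ul' 0%N e e0.
  have := lip l (u_ m); have := us m; lra.
have upl n : up (u_ n) l.
  rewrite /up; apply/ler_addgt0Pr => e e0.
  have [|m [nm ml]] := ul' n (e / (1 + c)); first by rewrite divr_gt0//; lra.
  have := uup _ _ nm; rewrite /up.
  have := lip (u_ m) l; rewrite distrC => fml.
  have := ler_distD (u_ m) l (u_ n); rewrite -(ler_pM2l c0) mulrDr.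
  move: ml; rewrite ltr_pdivlMr; last by lra.
  rewrite mulrDr mulr1 (mulrC _ c); lra.
exists l; split; last exact: (upl 0%N).
apply/eqP; rewrite eq_le fl /= leNgt; apply/negP => fls.
have fxl : f x <= f l by exact/up_le/(upl 0%N).
(* A further step from l would be reachable from every u_ n, yet the height
   gained from u_ n.+1 on is at most the height gained by the n-th step. *)
have [|z [zs flz lz]] := climb l; first by rewrite fxl fls.
have [n Vn] := Vapp (f z - f l) ltac:(lra).
have [_ _ /(_ z)] := gP _ (us n).
move=> /(_ (up_trans _ _ _ (upl n) lz) zs).
rewrite -/(u_ n.+1).
have := leV n.+1; have := up_le _ _ (upl n.+1); lra.
Qed.

Lemma differentiable_expansion (f : X -> R^o) x e :
  differentiable f x -> 0 < e ->
  exists2 del : R, 0 < del & forall h, `|h| <= del ->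
    `|f (x + h) - f x - 'd f x h| <= e * `|h|.
Proof.
move=> /diff_locallyP[_ /eqaddoP fo] e0.
have /nbhs_norm0P[d /= d0 dP] := fo e e0.
exists (d / 2); first by lra.
move=> h hd; have := dP h; rewrite /= /cst.
move=> /(_ ltac:(lra)).
rewrite -[(_ - _ : X -> R^o) h]/(f (h + x) - (f x + 'd f x h)).
by rewrite opprD addrA (addrC h).
Qed.

(** Moving towards an almost nearest point lowers the distance at almost unit
    rate.  The differential is linear, so moving the opposite way raises it at
    the same rate. *)
Lemma dist_to_ascent A y e t0 : A !=set0 -> 0 < dist_to A y ->
  differentiable (dist_to A : X -> R^o) y -> 0 < e -> 0 < t0 ->
  exists z, [/\ 0 < `|z - y|, `|z - y| <= t0 &
    (1 - e) * `|z - y| <= dist_to A z - dist_to A y].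
Proof.
move=> A0 d0 dd e0 t00.
have [del del0 delP] := differentiable_expansion _ _ (e / 3) dd ltac:(lra).
pose t := Num.min t0 (Num.min del (dist_to A y)).
have [tt0 tdel td tgt0] : [/\ t <= t0, t <= del, t <= dist_to A y & 0 < t].
  by rewrite /t !lt_min !ge_min !lexx !orbT t00 del0 d0.
have [a Aa ya] := dist_to_approx A y (e / 3 * t) A0 ltac:(apply: mulr_gt0; lra).
have dya := dist_to_le A y a Aa.
pose b := y - a; have b0 : b != 0 by rewrite -normr_gt0 /b; lra.
(* Descend along w towards a near-minimizer a, then go up along - w. *)
pose w := - (t *: direction b).
have wt : `|w| = t by rewrite /w normrN normrZ scale_unit// mulr1 gtr0_norm.
have yw : `|y + w - a| = `|y - a| - t.
  rewrite addrAC -/b (_ : b + w = (`|b| - t) *: direction b).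
    by rewrite normrZ scale_unit// mulr1 ger0_norm// subr_ge0 /b; lra.
  by rewrite scalerBl [X in _ = X - _]scalerA mulfV ?normr_eq0// scale1r.
have := delP w; rewrite wt => /(_ tdel); rewrite ler_norml => /andP[w1 _].
have := delP (- w); rewrite normrN wt => /(_ tdel).
rewrite ler_norml => /andP[w2 _].
have := dist_to_le A (y + w) a Aa; rewrite yw => w3.
exists (y - w); rewrite addrAC subrr add0r normrN wt; split => //.
have dN : 'd (dist_to A : X -> R^o) y (- w) = - 'd (dist_to A : X -> R^o) y w.
  exact: linearN.
move: w1 w2; rewrite dN; move: w3 ya; lra.
Qed.

(** Steps of slope almost 1 are available throughout the tube, so the chain they
    form has almost the least length that the Lipschitz bound allows. *)
Lemma dist_to_climb A x r s e :
  (forall y, tube r A y -> differentiable (dist_to A : X -> R^o) y) ->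
  A !=set0 -> 0 < dist_to A x -> dist_to A x <= s -> s < r -> 0 < e ->
  exists y, dist_to A y = s /\ `|y - x| <= s - dist_to A x + e.
Proof.
move=> dd A0 d0 ds sr e0.
(* A slope c with (s - d) / c <= s - d + e whenever 0 <= s - d <= s + 1. *)
pose c := (s + 1) / (s + 1 + e).
have c0 : 0 < c by rewrite divr_gt0//; lra.
have c1 : c < 1 by rewrite ltr_pdivrMr; lra.
have [|y [ys yx]] := slope_climb (dist_to A) x c s (dist_to_lipschitz A) c0 ds.
  move=> y /andP[xy ysl].
  have [|||||z [z0 zt zy]] := dist_to_ascent A y (1 - c) (s - dist_to A y).
  - exact: A0.
  - lra.
  - by apply: dd; rewrite /tube/=; apply/andP; split; lra.
  - lra.
  - lra.
  exists z; have := dist_to_lipschitz A z y; split.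
  - lra.
  - by have := mulr_gt0 c0 z0; lra.
  - lra.
exists y; split=> //; move: yx; rewrite ys /c mulrAC ler_pdivrMr; last by lra.
rewrite -subr_ge0 => h; rewrite -subr_ge0.
have : 0 <= (s + 1) * (s - dist_to A x + e - `|y - x|) by nra.
by rewrite pmulr_rge0//; lra.
Qed.

(** * Exterior balls at normals of a proximally smooth set *)

(** The climb from x = x0 + t u to height s is compared with the ray.  With a
    nearly nearest to x, b = y - x and c = x - a, uniform convexity gives that
    the direction of b is close to that of c, and that of c close to u. *)
Lemma normal_ray_dist A x0 p u s r : uniformly_convex X ->
  (forall y, tube r A y -> differentiable (dist_to A : X -> R^o) y) ->
  A x0 -> normal_cone x0 A p -> dual_norm p = 1 -> `|u| = 1 -> p u = 1 ->
  0 < s < r -> s <= dist_to A (x0 + s *: u).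
Proof.
move=> /uniform_convexityP Xuc dd Ax0 [_ pN] p1 u1 pu /andP[s0 sr].
have A0 : A !=set0 by exists x0.
apply/ler_addgt0Pr => e e0.
(* Two deviations of e / (4 s) move a point at distance s by at most e / 2. *)
have [del del0 delP] := Xuc (e / (4 * s)) ltac:(apply: divr_gt0; lra).
pose d1 := Num.min del 1.
have [d1del d11 d10] : [/\ d1 <= del, d1 <= 1 & 0 < d1].
  by rewrite /d1 lt_min !ge_min !lexx orbT del0 ltr01.
have {}delP v w : `|v| <= 1 -> `|w| <= 1 -> 2 - d1 < `|v + w| ->
    `|v - w| < e / (4 * s).
  by move=> v1 w1 vw; apply: delP => //; lra.
have [del0' del0'0 {}pN] := pN (d1 / 12) ltac:(lra).
pose t := Num.min (del0' / 3) (Num.min (e / 4) (s / 3)).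
have [tdel te ts t0] : [/\ t <= del0' / 3, t <= e / 4, t <= s / 3 & 0 < t].
  rewrite /t !ge_min !lexx !orbT; split => //.
  by rewrite !lt_min; apply/and3P; split; lra.
pose x := x0 + t *: u.
have xx0 : `|x - x0| = t.
  by rewrite /x addrAC subrr add0r normrZ u1 mulr1 gtr0_norm.
(* Normality of p at x0: near x0 the set A lies almost behind the hyperplane
   p = p x0, so p almost norms x - a for the points a of A close to x. *)
have px a : A a -> `|x - a| <= 2 * t -> t * (1 - d1 / 4) <= p (x - a).
  move=> Aa xa; have ax0 : `|a - x0| <= 3 * t.
    by have := ler_distD x a x0; rewrite xx0 (distrC a x); lra.
  have : p (a - x0) <= d1 / 12 * `|a - x0|.
    apply: pN; split=> //; rewrite closed_ballE// /closed_ball_/= distrC; lra.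
  have -> : x - a = t *: u - (a - x0).
    by rewrite /x opprB addrA; congr (_ - _); rewrite addrC.
  have -> : p (t *: u - (a - x0)) = t - p (a - x0).
    by rewrite linearB linearZ/= pu /GRing.scale/= mulr1.
  have : d1 / 12 * `|a - x0| <= d1 / 12 * (3 * t) by rewrite ler_pM2l//; lra.
  lra.
have dxt : dist_to A x <= t by rewrite -xx0; exact: dist_to_le.
have dxt' : t * (1 - d1 / 4) <= dist_to A x.
  apply: le_dist_to => // a Aa.
  have [xa|xa] := leP `|x - a| (2 * t).
    exact: le_trans (px a Aa xa) (dual_norm1_le p _ p1).
  have : 0 < t * d1 by exact: mulr_gt0.
  lra.
have td1 : 0 < t * d1 by exact: mulr_gt0.
have td1' : t * d1 <= t by rewrite ger_pMr.
(* The climb starts at height about t, so its error has to be small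
   compared with t. *)
pose e1 := t * d1 / 8.
have [y [dy yx]] :
    exists y, dist_to A y = s /\ `|y - x| <= s - dist_to A x + e1.
  by apply: (dist_to_climb A x r s e1) => //; rewrite /e1; lra.
have [a Aa xa] := dist_to_approx A x e1 A0 ltac:(rewrite /e1; lra).
have dxa := dist_to_le A x a Aa; have dya := dist_to_le A y a Aa.
have pxa : t * (1 - d1 / 4) <= p (x - a).
  by apply: px => //; rewrite /e1 in xa; lra.
have lyx := dist_to_lipschitz A y x.
have yxa : `|(y - x) + (x - a)| = `|y - a| by rewrite addrA subrK.
move: dya pxa; rewrite -yxa; move: xa yx dxa lyx.
rewrite dy {yxa}.
have -> : x0 + s *: u = y + ((s - t) *: u - (y - x)).
  by rewrite addrCA subKr /x scalerBl [x0 + t *: u]addrC addrA subrK addrC.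
have := dist_to_lipschitz A y (y + ((s - t) *: u - (y - x))).
have -> w : `|y - (y + w)| = `|w| by rewrite opprD addrA subrr add0r normrN.
rewrite dy.
set b := y - x; set c := x - a; set D := dist_to A _.
move=> lipD cle ble cge bge bcge pc.
have c0 : c != 0 by rewrite -normr_gt0; lra.
have b0 : b != 0 by rewrite -normr_gt0; lra.
have cb : `|c| <= `|b| by rewrite /e1 in cle; lra.
(* The path from a to x to y is almost as short as the distance from y to A,
   so b and c have almost the same direction. *)
have bc : `|direction b - direction c| < e / (4 * s).
  apply: delP; rewrite ?scale_unit//.
  have := norm_add_directions c b c0 cb => h.
  have cgt0 : 0 < `|c| by rewrite normr_gt0.
  rewrite -(ltr_pM2l cgt0) (lt_le_trans _ h)//.
  have : d1 * (t * (1 - d1 / 4)) <= d1 * `|c| by rewrite ler_pM2l//; lra.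
  have : 0 <= t * d1 * (1 - d1) by rewrite mulr_ge0//; lra.
  rewrite /e1 in cle ble; nra.
(* p almost norms c and norms u. *)
have cu : `|direction c - u| < e / (4 * s).
  apply: delP; rewrite ?scale_unit ?u1//.
  have := dual_norm1_le p (direction c + u) p1.
  rewrite linearD linearZ/= pu /GRing.scale/= => h.
  suff : 1 - d1 < `|c|^-1 * p c by lra.
  have cgt0 : 0 < `|c| by rewrite normr_gt0.
  rewrite ltr_pdivlMl//; apply: lt_le_trans pc.
  have : `|c| * (1 - d1) <= t * (1 + d1 / 8) * (1 - d1).
    by rewrite ler_wpM2r//; rewrite /e1 in cle; lra.
  have : 0 < t * d1 by []. nra.
have bs : `|b| <= s by rewrite /e1 in ble; lra.
have : `|(s - t) *: u - b| <=
    `|(s - t - `|b|) *: u| + `| `|b| *: (u - direction b)|.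
  apply: le_trans (ler_normD _ _); rewrite scalerBr norm_scale_unit.
  by rewrite [X in _ <= `|X + _|]scalerBl addrA subrK.
rewrite normrZ u1 mulr1 normrZ normr_id.
have : `|s - t - `|b| | <= t.
  by rewrite ler_norml; apply/andP; rewrite /e1 in ble; split; lra.
have : `|u - direction b| <= 2 * (e / (4 * s)).
  rewrite distrC; have := ler_distD (direction c) (direction b) u; lra.
move=> h1; have : `|b| * `|u - direction b| <= s * (2 * (e / (4 * s))).
  exact: ler_pM.
have -> : s * (2 * (e / (4 * s))) = e / 2 by field; rewrite gt_eqF.
lra.
Qed.

(** The limit s -> r of the previous bound; r itself is not a height reached
    inside the tube. *)
Lemma normal_ball_disjoint A x0 p u r a : uniformly_convex X ->
  (forall y, tube r A y -> differentiable (dist_to A : X -> R^o) y) ->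
  A x0 -> normal_cone x0 A p -> dual_norm p = 1 -> `|u| = 1 -> p u = 1 ->
  0 < r -> A a -> r <= `|x0 + r *: u - a|.
Proof.
move=> Xuc dd Ax0 pN p1 u1 pu r0 Aa; apply/ler_addgt0Pr => e e0.
pose s := Num.max (r - e / 2) (r / 2).
have [se sr s0] : [/\ r - e / 2 <= s, s < r & 0 < s].
  rewrite /s; split; first by rewrite le_max lexx.
    by rewrite gt_max; apply/andP; split; lra.
  by rewrite lt_max; apply/orP; right; lra.
have := normal_ray_dist A x0 p u s r Xuc dd Ax0 pN p1 u1 pu
  ltac:(by rewrite s0).
have := dist_to_le A (x0 + s *: u) a Aa.
have -> : x0 + s *: u - a = (x0 + r *: u - a) - (r - s) *: u.
  have -> : x0 + r *: u = x0 + s *: u + (r - s) *: u.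
    by rewrite -addrA -scalerDl addrCA subrr addr0.
  by rewrite [X in _ = X - _]addrAC addrK.
have := ler_normB (x0 + r *: u - a) ((r - s) *: u).
by rewrite [X in _ <= _ + X -> _]normrZ u1 mulr1 gtr0_norm ?subr_gt0//; lra.
Qed.

Lemma modulus_smoothness_ge x y : `|x| = 1 ->
  `|x + y| / 2 + `|x - y| / 2 - 1 <= modulus_smoothness X `|y|.
Proof.
move=> x1; apply: ub_le_sup; last by exists x, y.
exists `|y| => _ [x' [y' [x'1 y'y ->]]].
have := ler_normD x' y'; have := ler_normB x' y'; rewrite x'1 y'y; lra.
Qed.

(** With y = (a - x0) / r, the exterior ball gives |u - y| >= 1, while
    |u + y| >= p (u + y) = 1 + p y. *)
Lemma normal_le_modulus_smoothness A x0 p r a : uniformly_convex X ->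
  (forall y, tube r A y -> differentiable (dist_to A : X -> R^o) y) ->
  A x0 -> normal_cone x0 A p -> dual_norm p = 1 -> 0 < r -> A a ->
  p (a - x0) <= 2 * r * modulus_smoothness X (`|a - x0| / r).
Proof.
move=> Xuc dd Ax0 pN p1 r0 Aa.
have [u [u1 pu]] := norming_vector p Xuc p1.
have := normal_ball_disjoint A x0 p u r a Xuc dd Ax0 pN p1 u1 pu r0 Aa.
pose y := r^-1 *: (a - x0).
have ry : r *: y = a - x0 by rewrite /y scalerA mulfV ?gt_eqF// scale1r.
have -> : x0 + r *: u - a = r *: (u - y).
  by rewrite scalerBr ry opprB addrCA addrA.
rewrite normrZ gtr0_norm// -[X in X <= _]mulr1 ler_pM2l// => uy1.
have -> : `|a - x0| / r = `|y|.
  by rewrite /y normrZ gtr0_norm ?invr_gt0// mulrC.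
have := modulus_smoothness_ge u y u1.
have := dual_norm1_le p (u + y) p1; rewrite linearD pu => upy.
have -> : p (a - x0) = r * p y by rewrite -ry linearZ.
rewrite -mulrA mulrCA ler_pM2l//; move: upy uy1.
by rewrite /=; lra.
Qed.

Lemma Omega_PS_sub_Omega_N (psi : R -> R) : uniformly_convex X -> class_M psi ->
  (modulus_smoothness X : R -> R^o) =O_ (0^'+) (psi : R -> R^o) ->
  exists2 k1 : R, 0 < k1 & forall r : R, 0 < r ->
     Omega_PS X r `<=` Omega_N X (fun t => k1 * psi t) r.
Proof.
move=> Xuc [psi0 _ _ psi00] /eqO_exP[C /= C0 HC].
exists (4 * C); first by lra.
move=> r r0 A [Acl [dd _]]; split => //.
have [t0 /= t00 tP] : exists2 t0 : R, 0 < t0 &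
    forall t, 0 < t -> t <= t0 -> modulus_smoothness X t <= C * psi t.
  have [t0 /= t00 tP] := HC.
  exists (t0 / 2); first by lra.
  move=> t tgt0 tt0.
  have := tP t; rewrite /= sub0r normrN gtr0_norm// => /(_ ltac:(lra) tgt0).
  rewrite (ger0_norm (psi0 t (ltW tgt0))).
  exact: le_trans (ler_norm _).
(* With this radius |x2 - x1| / r stays where the modulus is below C psi. *)
exists (t0 * r); first exact: mulr_gt0.
move=> x1 x2 Ax1 Ax2 x12 p1 p2 pN1 pN2 p11 p21.
have [->|x1x2] := eqVneq x1 x2.
  by rewrite subrr normr0 mul0r psi00 !linear0; lra.
have d0 : 0 < `|x2 - x1| / r by rewrite divr_gt0// normr_gt0 subr_eq0 eq_sym.
have dt : `|x2 - x1| / r <= t0 by rewrite ler_pdivrMr// distrC.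
have := normal_le_modulus_smoothness A x1 p1 r x2 Xuc dd Ax1 pN1 p11 r0 Ax2.
have := normal_le_modulus_smoothness A x2 p2 r x1 Xuc dd Ax2 pN2 p21 r0 Ax1.
rewrite (distrC x1) -[x1 - x2]opprB linearN/=.
have := tP _ d0 dt; rewrite -(ler_pM2l r0).
move: (modulus_smoothness _ _) (psi _) => rho ps; lra.
Qed.

(** * The differential of the norm of a uniformly smooth space *)

Lemma linear_pack (f : X -> R^o) : linear f ->
  exists L : {linear X -> R^o}, L = f :> (X -> R^o).
Proof.
move=> lf.
pose L : {linear X -> R^o} :=
  HB.pack f (GRing.isLinear.Build R X R^o *:%R f lf).
by exists L.
Qed.

Lemma dominated_linear_continuous p :
  (forall h, `|p h| <= `|h|) -> continuous p.
Proof.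
move=> pb; apply: bounded_linear_continuous; apply/bounded_funP => r.
by exists r => h /(le_trans (pb h)).
Qed.

Lemma differentiable_of_expansion (f : X -> R^o) x (L : {linear X -> R^o}) :
  continuous L ->
  (forall e : R, 0 < e -> exists2 del : R, 0 < del & forall h, `|h| <= del ->
    `|f (x + h) - f x - L h| <= e * `|h|) ->
  differentiable f x /\ 'd f x = L :> (X -> R^o).
Proof.
move=> Lc Lo.
have fL : f \o shift x = cst (f x) + L +o_ 0 id.
  apply/eqaddoP => e e0; have [del del0 delP] := Lo e e0.
  apply/nbhs_norm0P; exists del => //= h /ltW /delP; rewrite /cst/=.
  rewrite -[(_ - _ : X -> R^o) h]/(f (h + x) - (f x + L h)).
  by rewrite opprD addrA (addrC h).
have dL := diff_unique Lc fL.
by split => //; apply/diff_locallyP; rewrite dL.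
Qed.

Lemma uniformly_smoothP e : uniformly_smooth X -> 0 < e ->
  exists2 del : R, 0 < del & forall t, 0 < t -> t <= del ->
    modulus_smoothness X t <= e * t.
Proof.
move=> /cvgrPdist_le Xus e0; have [d /= d0 dP] := Xus e e0.
exists (d / 2); first by lra.
move=> t t0 td; have := dP t; rewrite /= !sub0r !normrN gtr0_norm//.
move=> /(_ ltac:(lra) t0) h; rewrite -ler_pdivrMr//.
exact: le_trans (ler_norm _) h.
Qed.

Lemma norm_smooth x e : uniformly_smooth X -> x != 0 -> 0 < e ->
  exists2 del : R, 0 < del & forall h, `|h| <= del ->
    `|x + h| + `|x - h| - 2 * `|x| <= e * `|h|.
Proof.
move=> Xus x0 e0; have nx : 0 < `|x| by rewrite normr_gt0.
have [del del0 delP] := uniformly_smoothP (e / 2) Xus ltac:(lra).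
exists (del * `|x|); first exact: mulr_gt0.
move=> h hd; have [->|h0] := eqVneq h 0.
  by rewrite addr0 subr0 normr0 mulr0; lra.
pose u := direction x; pose v := `|x|^-1 *: h.
have xE : x = `|x| *: u by rewrite norm_scale_unit.
have hE : h = `|x| *: v by rewrite /v scalerA mulfV ?gt_eqF// scale1r.
have vE : `|v| = `|h| / `|x| by rewrite /v normrZ normfV normr_id mulrC.
have v0 : 0 < `|v| by rewrite vE divr_gt0// normr_gt0.
have vd : `|v| <= del by rewrite vE ler_pdivrMr.
have h1 := delP _ v0 vd.
have h2 := modulus_smoothness_ge u v (scale_unit x x0).
have -> : `|h| = `|x| * `|v| by rewrite {1}hE normrZ normr_id.
have -> : `|x + h| = `|x| * `|u + v|.
  by rewrite {1}xE {1}hE -scalerDr normrZ normr_id.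
have -> : `|x - h| = `|x| * `|u - v|.
  by rewrite {1}xE {1}hE -scalerBr normrZ normr_id.
have : `|x| * (`|u + v| / 2 + `|u - v| / 2 - 1) <= `|x| * (e / 2 * `|v|).
  by rewrite ler_pM2l//; lra.
lra.
Qed.

Lemma sublinear_odd_linear (g : X -> R^o) :
  (forall h k, g (h + k) <= g h + g k) ->
  (forall c h, 0 < c -> g (c *: h) <= c * g h) ->
  (forall h, g (- h) <= - g h) -> linear g.
Proof.
move=> gD gZ gN.
have {}gD h k : g (h + k) = g h + g k :> R.
  apply/eqP; rewrite eq_le gD/=.
  have := gD (h + k) (- k); rewrite addrK; have := gN k; lra.
have g0 : g 0 = 0 :> R by have := gD 0 0; rewrite addr0; lra.
have {}gN h : g (- h) = - g h :> R by have := gD h (- h); rewrite subrr g0; lra.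
have {}gZ c h : 0 < c -> g (c *: h) = c * g h :> R.
  move=> c0; apply/eqP; rewrite eq_le gZ//=.
  have := gZ c^-1 (c *: h); rewrite invr_gt0 scalerA mulVf ?gt_eqF// scale1r.
  by move=> /(_ c0); rewrite ler_pdivlMl.
move=> c h k; rewrite gD; congr (_ + _).
have [c0|c0|->] := ltgtP c 0.
- by rewrite -[c in LHS]opprK scaleNr gN gZ ?oppr_gt0// mulNr opprK.
- exact: gZ.
- by rewrite !scale0r g0.
Qed.

(** The infimum over t > 0 of the difference quotients in the direction h is a
    sublinear function of h, and smoothness makes it odd, hence linear. *)
Lemma norm_supporting_functional x : uniformly_smooth X -> x != 0 ->
  exists L : {linear X -> R^o}, forall h, (L h : R) <= `|x + h| - `|x|.
Proof.
move=> Xus x0.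
pose q t h : R := (`|x + t *: h| - `|x|) / t.
pose g h : R^o := inf [set q t h | t in [set t : R | 0 < t]].
have qlb h : has_lbound [set q t h | t in [set t : R | 0 < t]].
  exists (- `|h|) => _ [t /= t0 <-]; rewrite /q ler_pdivlMr//.
  have := lerB_normD x (t *: h).
  by rewrite normrZ gtr0_norm//; lra.
have gq t h : 0 < t -> g h <= q t h.
  by move=> t0; apply: ge_inf => //; exists t.
have qg h e : 0 < e -> exists t, 0 < t /\ q t h < g h + e.
  move=> e0; have [|_ [t t0 <-] qt] := @inf_adherent _ _ e e0
    (_ : has_inf [set q t h | t in [set t : R | 0 < t]]); last by exists t.
  by split => //; exists (q 1 h), 1 => //=.
have glin : linear g.
  apply: sublinear_odd_linear.
  - move=> h k; apply/ler_addgt0Pr => e e0.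
    have [s [s0 sq]] := qg h (e / 2) ltac:(lra).
    have [t [t0 tq]] := qg k (e / 2) ltac:(lra).
    have st0 : 0 < s + t by exact: addr_gt0.
    (* x + T (h + k) is a convex combination of x + s h and x + t k for
       T = s t / (s + t). *)
    have T0 : 0 < s * t / (s + t) by rewrite divr_gt0// mulr_gt0.
    have := gq _ (h + k) T0.
    suff : q (s * t / (s + t)) (h + k) <= q s h + q t k by lra.
    rewrite /q ler_pdivrMr// lerBlDr.
    have -> : x + (s * t / (s + t)) *: (h + k) =
       (t / (s + t)) *: (x + s *: h) + (s / (s + t)) *: (x + t *: k).
      rewrite !scalerDr !scalerA addrACA -scalerDl -mulrDl (addrC t s).
      rewrite divff ?gt_eqF// scale1r; congr (_ + (_ *: _ + _ *: _));
        by field; rewrite gt_eqF.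
    apply: le_trans (ler_normD _ _) _.
    rewrite (normrZ _ (x + s *: h)) (normrZ _ (x + t *: k)).
    rewrite (gtr0_norm (divr_gt0 t0 st0)) (gtr0_norm (divr_gt0 s0 st0)).
    rewrite le_eqVlt; apply/orP; left; apply/eqP; field.
    by rewrite (gt_eqF s0) (gt_eqF t0) (gt_eqF st0).
  - move=> c h c0; rewrite -ler_pdivrMl//; apply: lb_le_inf.
      by exists (q 1 h), 1 => //=.
    move=> _ [t /= t0 <-]; rewrite ler_pdivrMl//.
    apply: le_trans (gq (t / c) _ (divr_gt0 t0 c0)) _.
    rewrite /q scalerA divfK ?gt_eqF// le_eqVlt; apply/orP; left; apply/eqP.
    by field; rewrite (gt_eqF t0) (gt_eqF c0).
  - move=> h; rewrite -subr_le0 opprK; apply/ler_addgt0Pr => e e0.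
    rewrite add0r.
    have h1 : 0 < 1 + `|h| by have := normr_ge0 h; lra.
    have [del del0 delP] :=
      norm_smooth x (e / (1 + `|h|)) Xus x0 ltac:(exact: divr_gt0).
    pose t := del / (1 + `|h|).
    have t0 : 0 < t by exact: divr_gt0.
    have th : `|t *: h| = t * `|h| by rewrite normrZ gtr0_norm.
    have hs : `|h| / (1 + `|h|) <= 1 by rewrite ler_pdivrMr//; lra.
    have tdel : t * `|h| <= del.
      by rewrite /t mulrAC -mulrA ler_piMr// ltW.
    have := delP (t *: h); rewrite th => /(_ tdel) H.
    have {}H : `|x + t *: h| + `|x - t *: h| - 2 * `|x| <= e * t.
      apply: le_trans H _.
      rewrite [leLHS](_ : _ = e * t * (`|h| / (1 + `|h|))).
        by rewrite ler_piMr// ltW// mulr_gt0.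
      by field; rewrite gt_eqF.
    apply: le_trans (lerD (gq t (- h) t0) (gq t h t0)) _.
    by rewrite /q -mulrDl ler_pdivrMr// scalerN; lra.
have [L LE] := linear_pack g glin.
exists L => h; rewrite LE; have := gq 1 h ltr01.
by rewrite /q scale1r divr1.
Qed.

(** A supporting functional L is a Frechet derivative, since
    |x + h| - |x| - L h lies between 0 and |x + h| + |x - h| - 2|x|. *)
Lemma norm_diff x : uniformly_smooth X -> x != 0 ->
  differentiable (Num.norm : X -> R^o) x /\
  forall h, ('d (Num.norm : X -> R^o) x h : R) <= `|x + h| - `|x|.
Proof.
move=> Xus x0; have [L LP] := norm_supporting_functional x Xus x0.
have Lb h : `|L h| <= `|h|.
  rewrite ler_norml; apply/andP; split.
    have := LP (- h); rewrite linearN/=; have := ler_normB x h; lra.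
  have := LP h; have := ler_normD x h; lra.
have [|dN dE] := differentiable_of_expansion (Num.norm : X -> R^o) x L
  (dominated_linear_continuous L Lb).
  move=> e e0; have [del del0 delP] := norm_smooth x e Xus x0 e0.
  exists del => // h hd; have := delP h hd; have := LP h; have := LP (- h).
  rewrite linearN/= => l1 l2 l3; rewrite ger0_norm; lra.
by split => // h; rewrite dE.
Qed.

Definition dnorm x : {linear X -> R^o} := 'd (Num.norm : X -> R^o) x.

Context (Xus : uniformly_smooth X).

Lemma dnorm_le x h : x != 0 -> (dnorm x h : R) <= `|x + h| - `|x|.
Proof. by move=> /(norm_diff x Xus)[_]; exact. Qed.

Lemma dnorm_bound x h : x != 0 -> `|dnorm x h| <= `|h|.
Proof.
move=> x0; rewrite ler_norml; apply/andP; split.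
  have := dnorm_le x (- h) x0; rewrite linearN/=; have := ler_normB x h; lra.
have := dnorm_le x h x0; have := ler_normD x h; lra.
Qed.

Lemma dnorm_self x : x != 0 -> dnorm x x = `|x| :> R.
Proof.
move=> x0; have := dnorm_le x (- x) x0; rewrite linearN/= subrr normr0.
have := dnorm_bound x x x0; have := ler_norm (dnorm x x); lra.
Qed.

(** For t > 0, adding the support inequalities of the norm at x for t h and at y
    for - t h bounds t (dnorm x h - dnorm y h) by
    |x + t h| + |x - t h| - 2|x| + 2|x - y|; take t small, then y close to x. *)
Lemma dnorm_continuous x e : x != 0 -> 0 < e ->
  exists2 del : R, 0 < del & forall y, y != 0 -> `|x - y| <= del ->
    forall h, `|h| <= 1 -> `|dnorm y h - dnorm x h| <= e.
Proof.
move=> x0 e0; have [t t0 tP] := norm_smooth x (e / 2) Xus x0 ltac:(lra).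
exists (e * t / 4); first by rewrite divr_gt0// mulr_gt0.
move=> y y0 xy.
suff le1 h : `|h| <= 1 -> (dnorm x h : R) - dnorm y h <= e.
  move=> h h1; rewrite distrC ler_norml le1// andbT.
  by have := le1 (- h); rewrite normrN !linearN/= => /(_ h1); lra.
move=> h1.
have th : `|t *: h| <= t by rewrite normrZ gtr0_norm// ler_piMr// ltW.
have := tP _ th; have := dnorm_le x (t *: h) x0.
have := dnorm_le y (- (t *: h)) y0.
have -> : dnorm y (- (t *: h)) = - (t * dnorm y h) by rewrite linearN linearZ.
have -> : dnorm x (t *: h) = t * dnorm x h by rewrite linearZ.
have : e / 2 * `|t *: h| <= e / 2 * t by rewrite ler_pM2l//; lra.
have : `|y - t *: h| <= `|x - t *: h| + `|x - y|.
  have -> : y - t *: h = (x - t *: h) - (x - y).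
    by rewrite opprB [RHS]addrC addrA subrK.
  exact: ler_normB.
have : `|x| - `|y| <= `|x - y| by exact: lerB_dist.
rewrite -[_ <= e](ler_pM2l t0); lra.
Qed.

(** * The complement of the open unit ball *)

Definition outside : set X := [set x | 1 <= `|x|].

Lemma closed_outside : closed outside.
Proof.
have -> : outside = (Num.norm : X -> R) @^-1` [set t | 1 <= t] by [].
by apply: closed_comp; [move=> x _; exact: norm_continuous|exact: closed_ge].
Qed.

Lemma dist_outside x : x != 0 -> `|x| <= 1 -> dist_to outside x = 1 - `|x|.
Proof.
move=> x0 x1; have Ax : outside (direction x) by rewrite /outside/= scale_unit.
apply/eqP; rewrite eq_le; apply/andP; split.
  apply: le_trans (dist_to_le _ _ _ Ax) _.
  have {1}-> : x = `|x| *: direction x by rewrite norm_scale_unit.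
  rewrite -[X in _ - X]scale1r -scalerBl normrZ scale_unit// mulr1.
  by rewrite distrC ger0_norm// subr_ge0.
apply: le_dist_to; first by exists (direction x).
move=> a; rewrite /outside/= => a1.
by have := lerB_dist a x; rewrite distrC; lra.
Qed.

(** The centre 0 drops out because its distance to the set is at least 1. *)
Lemma tube_outside x : tube 1 outside x -> x != 0 /\ `|x| < 1.
Proof.
move=> /andP[d0 d1]; split.
  apply/eqP => x0; move: d0 d1; rewrite x0 => d0; apply/negP; rewrite -leNgt.
  have [A0|/set0P A0] := eqVneq outside set0.
    by move: d0; rewrite /dist_to A0 image_set0 inf0 ltxx.
  by apply: le_dist_to => // a; rewrite /outside/= sub0r normrN.
rewrite ltNge; apply/negP => x1.
by have := dist_to_le outside x x x1; rewrite subrr normr0; lra.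
Qed.

Lemma differential_dist_outside x : tube 1 outside x ->
  differentiable (dist_to outside : X -> R^o) x /\
  forall h, 'd (dist_to outside : X -> R^o) x h = - dnorm x h.
Proof.
move=> /tube_outside[x0 x1]; have nx : 0 < `|x| by rewrite normr_gt0.
have [dN _] := norm_diff x Xus x0.
have [|e e0|df dE] :=
  differentiable_of_expansion (dist_to outside) x (\- dnorm x).
- apply: dominated_linear_continuous => h /=.
  by rewrite normrN; exact: dnorm_bound.
- have [del del0 delP] := differentiable_expansion _ _ e dN e0.
  pose d := Num.min del (Num.min (`|x| / 2) (1 - `|x|)).
  exists d; first by rewrite /d !lt_min; apply/and3P; split; lra.
  move=> h; rewrite /d !le_min => /and3P[hdel hx h1].
  have xh0 : x + h != 0 by rewrite -normr_gt0; have := lerB_normD x h; lra.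
  have xh1 : `|x + h| <= 1 by have := ler_normD x h; lra.
  rewrite !dist_outside//; last exact: ltW.
  have -> : 1 - `|x + h| - (1 - `|x|) - (\- dnorm x) h =
            - (`|x + h| - `|x| - dnorm x h) :> R.
    by rewrite /=; move: (dnorm x h : R) => D; ring.
  by rewrite normrN; exact: delP.
by split => // h; rewrite dE.
Qed.

Lemma dual_norm_small (q : X -> R) e : 0 <= e ->
  (forall h, `|h| <= 1 -> `|q h| <= e) -> `|dual_norm q| <= e.
Proof.
move=> e0 qe; have q0 : [set `|q h| | h in [set h : X | `|h| <= 1]] `|q 0|.
  by exists 0 => //=; rewrite normr0.
have qub : ubound [set `|q h| | h in [set h : X | `|h| <= 1]] e.
  by move=> _ [h h1 <-]; exact: qe.
rewrite ger0_norm; first by apply: ge_sup => //; exists `|q 0|.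
by apply: le_trans (normr_ge0 (q 0)) _; apply: ub_le_sup => //; exists e.
Qed.

Lemma outside_Omega_PS : Omega_PS X 1 outside.
Proof.
split; first exact: closed_outside.
split=> [x /differential_dist_outside[]//|x tx].
have [x0 x1] := tube_outside x tx.
have [_ dx] := differential_dist_outside x tx.
apply/cvgr0Pnorm_le => e e0; rewrite near_withinE.
have [del del0 delP] := dnorm_continuous x e x0 e0.
apply/nbhs_normP; exists del => // y /= /ltW xy ty.
have [y0 y1] := tube_outside y ty.
have [_ dy] := differential_dist_outside y ty.
apply: dual_norm_small; first exact: ltW.
move=> h h1; rewrite /= dy dx -opprD normrN.
exact: delP.
Qed.

Lemma dual_norm_dnorm x : x != 0 -> dual_norm (\- dnorm x) = 1.
Proof.
move=> x0; apply/eqP; rewrite eq_le; apply/andP; split.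
  apply: le_trans (ler_norm _) _; apply: dual_norm_small => // h h1.
  by rewrite /= normrN; exact: le_trans (dnorm_bound x h x0) h1.
apply: ub_le_sup.
  exists 1 => _ [h h1 <-] /=.
  by rewrite normrN; exact: le_trans (dnorm_bound x h x0) h1.
exists (direction x); first by rewrite /= scale_unit.
rewrite /= linearZ/= dnorm_self// normrN /GRing.scale/= mulVf ?normr1//.
by rewrite normr_eq0.
Qed.

(** Points a outside the open ball have |a| - |x| >= 0, and this is
    dnorm x (a - x) up to a small multiple of |a - x|. *)
Lemma normal_cone_outside x : `|x| = 1 -> normal_cone x outside (\- dnorm x).
Proof.
move=> x1; have x0 : x != 0 by rewrite -normr_gt0 x1.
split.
  apply: dominated_linear_continuous => h /=.
  by rewrite normrN; exact: dnorm_bound.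
move=> e e0; have [dN _] := norm_diff x Xus x0.
have [del del0 delP] := differentiable_expansion _ _ e dN e0.
exists del => // a [a1]; rewrite closed_ballE// /closed_ball_/= distrC => /delP.
rewrite -/(dnorm x (a - x)) addrCA subrr addr0 x1 => /(le_trans (ler_norm _)).
by rewrite /outside/= in a1; lra.
Qed.

(** * From monotonicity of the differential on the sphere to the modulus *)

Lemma class_M_nondecreasing (psi : R -> R) s t : class_M psi ->
  0 <= s -> s <= t -> psi s <= psi t.
Proof.
move=> [psi_ge0 psi_cvx _ psi0] s0 st.
have [t0|t0] := leP t 0; first by rewrite (_ : s = t)//; lra.
have s1 : s / t <= 1 by rewrite ler_pdivrMr// mul1r.
have s2 : 0 <= s / t by rewrite divr_ge0// ltW.
have /(_ t 0) := psi_cvx (Itv01 s2 s1).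
rewrite !inE /= !in_itv/= lexx andbT (ltW t0) => /(_ isT isT).
rewrite convRE psi0 mulr0 addr0 /=.
have -> : conv (Itv01 s2 s1) (t : convex_lmodType R^o) 0 = s.
  by rewrite -[LHS]/(s / t * t + (1 - s / t) * 0) mulr0 addr0 divfK ?gt_eqF.
move=> /le_trans; apply.
by rewrite ler_piMl// psi_ge0// ltW.
Qed.

Lemma direction_neq0 z : z != 0 -> direction z != 0.
Proof. by move=> z0; rewrite -normr_gt0 scale_unit. Qed.

(** The differential of the norm at z is that at the direction of z, by
    homogeneity; the support inequality at z follows by scaling. *)
Lemma dnorm_direction_le z h : z != 0 ->
  (dnorm (direction z) h : R) <= `|z + h| - `|z|.
Proof.
move=> z0; have nz : 0 < `|z| by rewrite normr_gt0.
have := dnorm_le (direction z) (`|z|^-1 *: h) (direction_neq0 z z0).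
rewrite linearZ -scalerDr !normrZ normfV normr_id -mulrBr.
by rewrite ler_pM2l// invr_gt0.
Qed.

Lemma direction_lipschitz z1 z2 : z1 != 0 -> z2 != 0 ->
  `|direction z2 - direction z1| <= 2 * `|z2 - z1| / `|z2|.
Proof.
move=> z10 z20; have n2 : 0 < `|z2| by rewrite normr_gt0.
have n1 : 0 < `|z1| by rewrite normr_gt0.
rewrite ler_pdivlMr// mulrC -{1}[`|z2|]gtr0_norm// -normrZ.
rewrite scalerBr norm_scale_unit.
have -> : z2 - `|z2| *: direction z1 =
    (z2 - z1) + (`|z1| - `|z2|) *: direction z1.
  by rewrite scalerBl norm_scale_unit addrA subrK.
apply: le_trans (ler_normD _ _) _.
rewrite normrZ scale_unit// mulr1.
have := ler_dist_dist z1 z2; rewrite (distrC z1); lra.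
Qed.

(** With unit vectors x1, x2 and z_i = |z_i| x_i, the left-hand side is
    |z1| (1 - dnorm x2 x1) + |z2| (1 - dnorm x1 x2), a combination of the two
    nonnegative terms whose sum is (dnorm x2 - dnorm x1)(x2 - x1). *)
Lemma dnorm_direction_monotone (psi : R -> R) (K eps : R) z1 z2 :
  class_M psi -> 0 <= K ->
  (forall x1 x2, `|x1| = 1 -> `|x2| = 1 -> `|x1 - x2| <= eps ->
    (dnorm x2 (x2 - x1) : R) - dnorm x1 (x2 - x1) <= K * psi `|x2 - x1|) ->
  1 / 2 <= `|z1| <= 3 / 2 -> 1 / 2 <= `|z2| <= 3 / 2 ->
  4 * `|z2 - z1| <= eps ->
  (dnorm (direction z2) (z2 - z1) : R) - dnorm (direction z1) (z2 - z1) <=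
    3 / 2 * K * psi (4 * `|z2 - z1|).
Proof.
move=> psiM K0 mono /andP[z1l z1u] /andP[z2l z2u] zeps.
have z10 : z1 != 0 by rewrite -normr_gt0; lra.
have z20 : z2 != 0 by rewrite -normr_gt0; lra.
set x1 := direction z1; set x2 := direction z2.
have x11 : `|x1| = 1 by exact: scale_unit.
have x21 : `|x2| = 1 by exact: scale_unit.
have x10 : x1 != 0 by exact: direction_neq0.
have x20 : x2 != 0 by exact: direction_neq0.
have d4 : `|x2 - x1| <= 4 * `|z2 - z1|.
  apply: le_trans (direction_lipschitz z1 z2 z10 z20) _.
  rewrite ler_pdivrMr; last by lra.
  by have := normr_ge0 (z2 - z1); nra.
have zE : z2 - z1 = `|z2| *: x2 - `|z1| *: x1 by rewrite !norm_scale_unit.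
clearbody x1 x2.
have := mono x1 x2 x11 x21; rewrite distrC => /(_ ltac:(lra)).
have psile := class_M_nondecreasing psi _ _ psiM (normr_ge0 (x2 - x1)) d4.
have -> : dnorm x2 (x2 - x1) = 1 - dnorm x2 x1 :> R.
  by rewrite linearB/= dnorm_self// x21.
have -> : dnorm x1 (x2 - x1) = dnorm x1 x2 - 1 :> R.
  by rewrite linearB/= dnorm_self// x11.
have -> : dnorm x2 (z2 - z1) = `|z2| - `|z1| * dnorm x2 x1 :> R.
  by rewrite zE linearB !linearZ/= dnorm_self// x21 /GRing.scale/= mulr1.
have -> : dnorm x1 (z2 - z1) = `|z2| * dnorm x1 x2 - `|z1| :> R.
  by rewrite zE linearB !linearZ/= dnorm_self// x11 /GRing.scale/= mulrN1.
have : (dnorm x2 x1 : R) <= 1.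
  by rewrite -x11; exact: le_trans (ler_norm _) (dnorm_bound x2 x1 x20).
have : (dnorm x1 x2 : R) <= 1.
  by rewrite -x21; exact: le_trans (ler_norm _) (dnorm_bound x1 x2 x10).
move: (dnorm x1 x2 : R) (dnorm x2 x1 : R) => c12 c21 c12le c21le cK.
have : K * psi `|x2 - x1| <= K * psi (4 * `|z2 - z1|) by exact: ler_wpM2l.
have : `|z1| * (1 - c21) <= 3 / 2 * (1 - c21) by rewrite ler_wpM2r//; lra.
have : `|z2| * (1 - c12) <= 3 / 2 * (1 - c12) by rewrite ler_wpM2r//; lra.
lra.
Qed.

(** By convexity of the norm, the second difference of the norm along y is at
    most the increment of its derivative in the direction y from x - y to x + y,
    a sum of eight increments to which monotonicity applies. *)
Lemma second_difference_le (psi : R -> R) (K eps : R) x y :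
  class_M psi -> 0 <= K ->
  (forall x1 x2, `|x1| = 1 -> `|x2| = 1 -> `|x1 - x2| <= eps ->
    (dnorm x2 (x2 - x1) : R) - dnorm x1 (x2 - x1) <= K * psi `|x2 - x1|) ->
  `|x| = 1 -> `|y| <= 1 / 2 -> `|y| <= eps ->
  `|x + y| / 2 + `|x - y| / 2 - 1 <= 24 * K * psi `|y|.
Proof.
move=> psiM K0 mono x1 y2 yeps.
(* Two neighbours z n, z n.+1 have directions at distance at most |y|, which is
   where the step 1/4 comes from. *)
pose z (n : nat) := x + (n%:R / 4 - 1) *: y.
have z0 : z 0%N = x - y by rewrite /z mul0r sub0r scaleN1r.
have z8 : z 8%N = x + y by rewrite /z (_ : 8%:R / 4 - 1 = 1) ?scale1r//; lra.
have zb n : (n <= 8)%N -> 1 / 2 <= `|z n| <= 3 / 2.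
  move=> n8; have n8' : n%:R <= 8 :> R by rewrite ler_nat.
  have n0 : 0 <= n%:R :> R by [].
  have t1 : `|n%:R / 4 - 1| <= 1 :> R.
    by rewrite ler_norml; apply/andP; split; lra.
  have ty : `|(n%:R / 4 - 1) *: y| <= 1 / 2.
    rewrite normrZ; apply: le_trans y2.
    by rewrite -[leRHS]mul1r ler_wpM2r.
  have := ler_normD x ((n%:R / 4 - 1) *: y).
  have := lerB_normD x ((n%:R / 4 - 1) *: y).
  by rewrite -/(z n) x1; move=> *; apply/andP; split; lra.
have zS n : z n.+1 - z n = 4^-1 *: y.
  rewrite /z opprD addrACA subrr add0r -scalerBl; congr (_ *: _).
  by rewrite -natr1; lra.
have nzS n : 4 * `|z n.+1 - z n| = `|y|.
  by rewrite zS normrZ gtr0_norm ?invr_gt0// mulrA divff ?mul1r// pnatr_eq0.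
have key n : (n <= 8)%N -> (dnorm (direction (z n)) y : R) -
    dnorm (direction (z 0%N)) y <= n%:R * (6 * K * psi `|y|).
  elim: n => [_|n IH n8]; first by rewrite subrr mul0r.
  have := IH (ltnW n8).
  have := dnorm_direction_monotone psi K eps (z n) (z n.+1) psiM K0 mono
    (zb n (ltnW n8)) (zb _ n8).
  rewrite nzS zS => /(_ yeps); rewrite !linearZ/= /GRing.scale/=.
  rewrite -(natr1 n); lra.
have zn0 n : (n <= 8)%N -> z n != 0.
  by move=> /zb /andP[h _]; rewrite -normr_gt0; lra.
have := key 8%N (leqnn _).
have := dnorm_direction_le (z 8%N) (- y) (zn0 8%N (leqnn _)).
have := dnorm_direction_le (z 0%N) y (zn0 0%N (leq0n _)).
rewrite z0 z8 subrK addrK linearN x1/=; lra.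
Qed.

Lemma bigO_of_Omega_PS_sub (psi : R -> R) : class_M psi ->
  (exists2 k1 : R, 0 < k1 & forall r : R, 0 < r ->
     Omega_PS X r `<=` Omega_N X (fun t => k1 * psi t) r) ->
  (modulus_smoothness X : R -> R^o) =O_ (0^'+) (psi : R -> R^o).
Proof.
move=> psiM [K K0 /(_ 1 ltr01)].
move=> /(_ _ outside_Omega_PS)[_ [eps eps0 epsP]].
have mono x1 x2 : `|x1| = 1 -> `|x2| = 1 -> `|x1 - x2| <= eps ->
    (dnorm x2 (x2 - x1) : R) - dnorm x1 (x2 - x1) <= K * psi `|x2 - x1|.
  move=> x11 x21 x12.
  have x10 : x1 != 0 by rewrite -normr_gt0 x11.
  have x20 : x2 != 0 by rewrite -normr_gt0 x21.
  have A1 : outside x1 by rewrite /outside/= x11.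
  have A2 : outside x2 by rewrite /outside/= x21.
  have := epsP x1 x2 A1 A2 x12 _ _ (normal_cone_outside x1 x11)
    (normal_cone_outside x2 x21) (dual_norm_dnorm x1 x10)
    (dual_norm_dnorm x2 x20).
  by rewrite /= divr1; lra.
have psi_ge0 : forall t, 0 <= t -> 0 <= psi t by case: psiM.
apply/eqO_exP; exists (24 * K); first by lra.
exists (Num.min (1 / 2) eps); first by rewrite /= lt_min eps0 andbT; lra.
move=> t /=; rewrite sub0r normrN lt_min => /andP[t2 teps] t0.
rewrite gtr0_norm// in t2 teps.
have pt : 0 <= 24 * K * psi t by rewrite !mulr_ge0// ?psi_ge0// ltW.
rewrite (ger0_norm (psi_ge0 t (ltW t0))).
rewrite /modulus_smoothness; set S := [set r | _].
have [S0|/set0P[_ [x [y [x1 yt _]]]]] := eqVneq S set0.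
  by rewrite S0 sup0 normr0.
have Sle : ubound S (24 * K * psi t).
  move=> _ [x' [y' [x'1 y't ->]]]; rewrite -y't.
  by apply: (second_difference_le psi K eps) => //; rewrite ?y't ltW.
rewrite ger0_norm.
  by apply: ge_sup Sle; exists (`|x + y| / 2 + `|x - y| / 2 - 1), x, y.
apply: le_trans (_ : `|x + y| / 2 + `|x - y| / 2 - 1 <= _).
  have := ler_normD (x + y) (x - y); rewrite addrACA subrr addr0.
  by rewrite -[x + x]mulr2n normrMn x1; lra.
by apply: ub_le_sup; [exists (24 * K * psi t)|exists x, y].
Qed.

End Banach.

Theorem theorem1 (R : realType) (X : completeNormedModType R) (psi : R -> R)
    (X_uconvex : uniformly_convex X) (X_usmooth : uniformly_smooth X)
    (psi_M : class_M psi) :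
  (exists2 k1 : R, 0 < k1 &
     forall r : R, 0 < r ->
       Omega_PS X r `<=` Omega_N X (fun t => k1 * psi t) r)
  <->
  (modulus_smoothness X : R -> R^o) =O_ (0^'+) (psi : R -> R^o).
Proof.
split; first exact: bigO_of_Omega_PS_sub.
exact: Omega_PS_sub_Omega_N.
Qed.
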